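(* Let $I\subset\mathbb{R}$ be an open interval (for instance $I=\mathbb{R}$), let $\alpha,\beta,\gamma,\theta\in C^2(I)$ be real-valued, and let $X=(x,y,z):\mathbb{R}\times I\to\mathbb{R}^3$ be the map $$x=s\sin\theta(t)+\alpha(t),\quad y=-s\cos\theta(t)+\beta(t),\quad z=s[\beta(t)\sin\theta(t)+\alpha(t)\cos\theta(t)]+\gamma(t).$$ Put $\delta(t)=\alpha(t)\cos\theta(t)+\beta(t)\sin\theta(t)$ and $\xi(t)=\alpha(t)\sin\theta(t)-\beta(t)\cos\theta(t)$, so that $(\alpha,\beta)=\delta(\cos\theta,\sin\theta)+\xi(\sin\theta,-\cos\theta)$. For $t\in I$ let $\Gamma_t=\{(x,y)\in\mathbb{R}^2: (x-\alpha(t))\cos\theta(t)+(y-\beta(t))\sin\theta(t)=0\}$. (a) $X$ is an immersion if and only if for every $(s,t)\in\mathbb{R}\times I$ at least one of the following two equations fails to hold: $$(s+\xi(t))\theta'(t)+\delta'(t)=0,\qquad s\delta'(t)+\gamma'(t)-\delta(t)\big(\xi'(t)-\delta(t)\theta'(t)\big)=0.$$ (b) $X$ is singular at $(s,t)$ if and only if, at $(s,t)$, $$[(s+\xi)^2+\delta^2]\theta'+(2s+\xi)\delta'+\gamma'-\delta\xi'=0.$$ (c) Suppose $\xi\equiv 0$. For $t_1\neq t_2$ in $I$ write $\delta_i=\delta(t_i)$, $\theta_i=\theta(t_i)$, $\gamma_i=\gamma(t_i)$. Then $X$ is injective if and only if for all $t_1\ne t_2$ in $I$ the following two conditions hold: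 (i) if $\Gamma_{t_1}\cap\Gamma_{t_2}$ consists of exactly one point, then $$\frac{2\delta_1\delta_2-(\delta_1^2+\delta_2^2)\cos(\theta_2-\theta_1)}{\sin(\theta_2-\theta_1)}+\gamma_2-\gamma_1\neq 0;$$ (ii) if $\Gamma_{t_1}=\Gamma_{t_2}$, then $\gamma_1\neq\gamma_2$.
   Context: The 3-dimensional Heisenberg group $H_1$ is identified with $\mathbb{R}^3$ (coordinates $x,y,z$), with contact form $\Theta=dz+x\,dy-y\,dx$. The map $X$ is called singular at $(s,t)$ if $\partial_sX\times\partial_tX$ at $(s,t)$ is parallel to (i.e. a real multiple, possibly zero, of) the vector $(-y,x,1)$, where $(x,y,z)=X(s,t)$; this is a generalized definition that applies also at points where $X$ is not an immersion. The line $\Gamma_t$ is the projection to the $xy$-plane of the straight line $\tilde\Gamma_t=X(\mathbb{R}\times\{t\})$. The expression in (c)(i) is the difference of the $z$-coordinates of the points of $\tilde\Gamma_{t_2}$ and $\tilde\Gamma_{t_1}$ lying over the common point of $\Gamma_{t_1}$ and $\Gamma_{t_2}$. *)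

(* Defs.v *)
From HB Require Import structures.
From mathcomp Require Import all_boot all_order all_algebra.
From mathcomp Require Import all_classical all_reals all_analysis.

Set Implicit Arguments.
Unset Strict Implicit.
Unset Printing Implicit Defensive.

Import Order.TTheory GRing.Theory Num.Theory.
Import numFieldNormedType.Exports.

Local Open Scope ring_scope.
Local Open Scope classical_set_scope.

(* Functions on I are represented by total functions on R.  Since I is open,
   the derivatives at points of I depend only on the values on I. *)
Definition C2 (R : realType) (I : set R) (f : R -> R) : Prop :=
  forall t, I t ->
    [/\ derivable f t 1, derivable f^`() t 1 & {for t, continuous f^`(2)}].

Definition immersion_on (R : realType) (V W : normedModType R) (D : set V)
    (F : V -> W) : Prop :=
  forall p, D p -> differentiable F p /\ injective ('d F p).

Definition cross (R : realType) (u v : R * R * R) : R * R * R :=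
  let: (u1, u2, u3) := u in
  let: (v1, v2, v3) := v in
  (u2 * v3 - u3 * v2, u3 * v1 - u1 * v3, u1 * v2 - u2 * v1).

(* (-y, x, 1) is the coefficient vector of the contact form
   dz + x dy - y dx at (x, y, z).  F need not be an immersion at p. *)
Definition singular_at (R : realType) (F : R * R -> R * R * R) (p : R * R)
    : Prop :=
  let: (x, y, _) := F p in
  exists k : R, cross ('D_(1, 0) F p) ('D_(0, 1) F p) = k *: (- y, x, 1).

Section RuledMap.
Variables (R : realType) (alpha beta gamma theta : R -> R).

Definition X (p : R * R) : R * R * R :=
  let: (s, t) := p in
  (s * sin (theta t) + alpha t,
   - s * cos (theta t) + beta t,
   s * (beta t * sin (theta t) + alpha t * cos (theta t)) + gamma t).

Definition delta (t : R) : R :=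
  alpha t * cos (theta t) + beta t * sin (theta t).

Definition xi (t : R) : R :=
  alpha t * sin (theta t) - beta t * cos (theta t).

Definition Gamma (t : R) : set (R * R) :=
  [set q | (q.1 - alpha t) * cos (theta t)
           + (q.2 - beta t) * sin (theta t) = 0].

End RuledMap.

(* Main.v *)
Require Import Defs.
From HB Require Import structures.
From mathcomp Require Import all_boot all_order all_algebra.
From mathcomp Require Import all_classical all_reals all_analysis.
From mathcomp Require Import ring.
Import Order.TTheory GRing.Theory Num.Theory.
Import numFieldNormedType.Exports.
Local Open Scope ring_scope.
Local Open Scope classical_set_scope.

(** Write [e1 = (sin theta, - cos theta)] and [e2 = (cos theta, sin theta)] for
the orthonormal frame that turns with the line [Gamma t]: [e1] directs the line
and [delta] and [xi] are the coordinates of [(alpha, beta)] along [e2] and [e1].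
In this frame [X (s, t)] is [(s + xi) e1 + delta e2] at height
[s * delta + gamma] ([X_frame]), and its partial derivatives are
- along [s]: [e1], with vertical component [delta];
- along [t]: [A e1 + B e2], with vertical component [s * delta' + gamma'],

where [A = xi' - delta * theta'] and [B = (s + xi) * theta' + delta']
([along_line], [across_line]).

Immersions and singular points are then linear algebra in this frame. The two
partial derivatives are dependent exactly when the second is [A] times the
first, which gives the two equations of the first part
([frame_injectiveP]). Their cross product has components [- delta * B] on [e1],
[delta * A - (s * delta' + gamma')] on [e2] and [B] vertically, while
[(- y, x, 1)] has components [- delta], [s + xi] and [1]; the factor of
proportionality must therefore be [B], the [e1] components agree automatically,
and the [e2] components give the equation of the second part
([frame_cross_parallelP]).

For injectivity, a coincidence [X (a, t1) = X (b, t2)] with [t1 <> t2] is a point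
common to [Gamma t1] and [Gamma t2] over which both lines have the same height.
Comparing the two frames, which differ by a rotation by [theta t2 - theta t1],
determines the parameters of the common points ([same_projectionP]). If the sine
of that angle is nonzero, there is exactly one such point and the gap in height
over it is the expression of the third part ([height_gap]). Otherwise the lines are
parallel, a common point makes them equal, and since [xi = 0] both parameters
have their origin at the foot of the perpendicular from the origin of the plane,
so that the gap is [gamma t2 - gamma t1] ([height_gap_parallel]). *)

(** * Differentials of the coordinates *)

Lemma is_diff_fst {R : realType} (p : R * R) :
  is_diff p (fun q : R * R => q.1) (fun q => q.1).
Proof.
have cfst : continuous (fst : R * R -> R) by move=> q; exact: cvg_fst.
apply: DiffDef; first exact: (@linear_differentiable _ _ _ fst).
exact: (@diff_lin _ _ _ fst).
Qed.

Lemma is_diff_snd {R : realType} (p : R * R) :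
  is_diff p (fun q : R * R => q.2) (fun q => q.2).
Proof.
have csnd : continuous (snd : R * R -> R) by move=> q; exact: cvg_snd.
apply: DiffDef; first exact: (@linear_differentiable _ _ _ snd).
exact: (@diff_lin _ _ _ snd).
Qed.

Lemma is_diff_of_derive1 {R : realType} (u : R -> R) (t du : R) :
  is_derive t 1 u du -> is_diff t u (fun h => h * du).
Proof.
move=> [du1 du2]; have dut : differentiable u t by exact/derivable1_diffP.
by apply: DiffDef => //; rewrite diff1E // derive1E du2.
Qed.

(** All three coordinates of a map ruled by lines have this shape. *)
Lemma is_diff_ruled {R : realType} {u v : R -> R} (s : R) {t du dv : R} :
  is_derive t 1 u du -> is_derive t 1 v dv ->
  is_diff (s, t) (fun p : R * R => p.1 * u p.2 + v p.2)
    (fun h => h.1 * u t + h.2 * (s * du + dv)).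
Proof.
move=> /is_diff_of_derive1 du' /is_diff_of_derive1 dv'.
have d1 := is_diff_fst (s, t); have d2 := is_diff_snd (s, t).
have du2 := is_diff_comp d2 du'; have dv2 := is_diff_comp d2 dv'.
have := is_diffD (is_diffM d1 du2) dv2.
move=> /is_diff_eq; apply; apply/funext => h.
rewrite /= !fctE /= /GRing.scale /=; ring.
Qed.

(** * Linear algebra in a rotated frame *)

(** The vectors [(S, - C, d)] and [(a, b, z)] are independent unless the second
is a multiple of the first; the factor can only be its component
[a * S - b * C] along the direction [(S, - C)]. *)
Lemma frame_injectiveP {R : realType} {S C d a b z : R} :
  C ^+ 2 + S ^+ 2 = 1 ->
  injective (fun h : R * R =>
    (h.1 * S + h.2 * a, - h.1 * C + h.2 * b, h.1 * d + h.2 * z)) <->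
  ~ (a * C + b * S = 0 /\ z - d * (a * S - b * C) = 0).
Proof.
move=> cs; split=> [inj [B0 E0]|indep [h k] [h' k'] /= [e1 e2 e3]].
  (* the kernel vector that the two equations provide *)
- have [_ /eqP] : (- (a * S - b * C), 1) = (0, 0) :> R * R.
    apply: inj => /=; congr (_, _).
      rewrite !mul0r addr0 oppr0 mul0r addr0; congr (_, _).
      + transitivity (a * (1 - (C ^+ 2 + S ^+ 2)) + C * (a * C + b * S)).
          by ring.
        by rewrite cs B0; ring.
      + transitivity (b * (1 - (C ^+ 2 + S ^+ 2)) + S * (a * C + b * S)).
          by ring.
        by rewrite cs B0; ring.
    by rewrite !mul0r addr0 -E0; ring.
  by rewrite oner_eq0.
- have {}e1 : (h - h') * S + (k - k') * a = 0.
    by transitivity (h * S + k * a - (h' * S + k' * a)); [ring|rewrite e1 subrr].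
  have {}e2 : - (h - h') * C + (k - k') * b = 0.
    by transitivity (- h * C + k * b - (- h' * C + k' * b));
      [ring|rewrite e2 subrr].
  have {}e3 : (h - h') * d + (k - k') * z = 0.
    by transitivity (h * d + k * z - (h' * d + k' * z)); [ring|rewrite e3 subrr].
  move: (h - h') (k - k') (subr_eq0 h h') (subr_eq0 k k') e1 e2 e3.
  move=> u v hu kv e1 e2 e3.
  have uE : u = - (v * (a * S - b * C)).
    transitivity (u * (C ^+ 2 + S ^+ 2)); first by rewrite cs mulr1.
    transitivity (S * (u * S + v * a) - C * (- u * C + v * b)
      - v * (a * S - b * C)); first by ring.
    by rewrite e1 e2; ring.
  have vB : v * (a * C + b * S) = 0.
    transitivity (C * (u * S + v * a) + S * (- u * C + v * b)); first by ring.
    by rewrite e1 e2; ring.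
  have vE : v * (z - d * (a * S - b * C)) = 0 by rewrite -e3 uE; ring.
  have v0 : v = 0.
    apply/eqP/negPn/negP => vN0; apply: indep; split; apply: (mulfI vN0).
      by rewrite vB mulr0.
    by rewrite vE mulr0.
  congr (_, _); apply/eqP; first by rewrite -hu uE v0 mul0r oppr0.
  by rewrite -kv v0.
Qed.

(** Comparison of the last coordinates forces [k = a * C + b * S]. What remains
of the other two coordinates is the multiple [(E * C, E * S)] of a unit vector,
where [E] is the expression on the right. *)
Lemma frame_cross_parallelP {R : realType} {S C d a b z r : R} :
  C ^+ 2 + S ^+ 2 = 1 ->
  (exists k, cross (S, - C, d) (a, b, z)
             = k *: (- (- r * C + d * S), r * S + d * C, 1)) <->
  r * (a * C + b * S) + z - d * (a * S - b * C) = 0.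
Proof.
move=> cs; set B := a * C + b * S; set A := a * S - b * C.
pose E := r * B + z - d * A; rewrite -/E.
have EC : E * C = B * - (- r * C + d * S) - (- C * z - d * b).
  transitivity (B * - (- r * C + d * S) - (- C * z - d * b)
    - d * b * (1 - (C ^+ 2 + S ^+ 2))); first by rewrite /E /A /B; ring.
  by rewrite cs; ring.
have ES : E * S = B * (r * S + d * C) - (d * a - S * z).
  transitivity (B * (r * S + d * C) - (d * a - S * z)
    + d * a * (1 - (C ^+ 2 + S ^+ 2))); first by rewrite /E /A /B; ring.
  by rewrite cs; ring.
split=> [[k [e1 e2 e3]]|E0].
- have kB : k = B by rewrite -[LHS]mulr1 -[k * 1]e3 /B; ring.
  rewrite -[E]mulr1 -cs mulrDr !expr2 !mulrA EC ES e1 e2 kB !subrr.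
  by rewrite !mul0r addr0.
- exists B; rewrite /cross; congr (_, _, _).
  + by apply/esym/eqP; rewrite -subr_eq0 -EC E0 mul0r.
  + by apply/esym/eqP; rewrite -subr_eq0 -ES E0 mul0r.
  + by rewrite /B /GRing.scale /=; ring.
Qed.

(** * The moving frame *)

Section MovingFrame.
Context {R : realType} (alpha beta gamma theta : R -> R).
Local Notation X := (X alpha beta gamma theta).
Local Notation delta := (delta alpha beta theta).
Local Notation xi := (xi alpha beta theta).
Local Notation Gamma := (Gamma alpha beta theta).

Lemma X_frame (s t : R) :
  X (s, t) = ((s + xi t) * sin (theta t) + delta t * cos (theta t),
              - (s + xi t) * cos (theta t) + delta t * sin (theta t),
              s * delta t + gamma t).
Proof.
have c2s2 := cos2Dsin2 (theta t).
rewrite /X /xi /delta; congr (_, _, _).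
- rewrite -[alpha t in LHS]mulr1 -c2s2; ring.
- rewrite -[beta t in LHS]mulr1 -c2s2; ring.
- ring.
Qed.

Lemma Gamma_frame (t : R) (q : R * R) :
  Gamma t q <-> q.1 * cos (theta t) + q.2 * sin (theta t) = delta t.
Proof.
rewrite /Gamma /= /delta.
set u := (X in X = 0); set v := (X in X = _ + _); set w := (X in v = X).
have -> : u = v - w by rewrite /u /v /w; ring.
by split=> [/eqP|->]; [rewrite subr_eq0 => /eqP|rewrite subrr].
Qed.

(** The line [Gamma t] is the projection of the ruling [X (., t)]. *)
Lemma Gamma_pointP (t : R) (q : R * R) :
  Gamma t q <-> exists s, (X (s, t)).1 = q.
Proof.
have c2s2 := cos2Dsin2 (theta t).
split=> [/Gamma_frame|[s <-]].
- case: q => x y; rewrite [_.1]/= [_.2]/= => xy.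
  exists (x * sin (theta t) - y * cos (theta t) - xi t).
  rewrite X_frame -xy /= subrK; congr (_, _).
  + rewrite -[RHS]mulr1 -c2s2; ring.
  + rewrite -[RHS]mulr1 -c2s2; ring.
- apply/Gamma_frame; rewrite X_frame /=.
  rewrite -[RHS]mulr1 -c2s2; ring.
Qed.

(** * Coincidences over common points of two lines *)

(** A point of the plane has coordinates [(a + xi t1, delta t1)] in the frame at
[t1] and [(b + xi t2, delta t2)] in the frame at [t2]; the right-hand side is the
rotation that changes one frame into the other. *)
Lemma same_projectionP (a b t1 t2 : R) :
  (X (a, t1)).1 = (X (b, t2)).1 <->
  b + xi t2 = (a + xi t1) * cos (theta t2 - theta t1)
              + delta t1 * sin (theta t2 - theta t1) /\
  delta t2 = delta t1 * cos (theta t2 - theta t1)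
             - (a + xi t1) * sin (theta t2 - theta t1).
Proof.
have c1 := cos2Dsin2 (theta t1); have c2 := cos2Dsin2 (theta t2).
rewrite !X_frame /= cosB sinB.
move: (a + xi t1) (b + xi t2) (delta t1) (delta t2) => A B d1 d2.
set C1 := cos (theta t1) in c1 *; set S1 := sin (theta t1) in c1 *.
set C2 := cos (theta t2) in c2 *; set S2 := sin (theta t2) in c2 *.
split=> [[ex ey]|[-> ->]].
- split.
  + transitivity (S2 * (B * S2 + d2 * C2) - C2 * (- B * C2 + d2 * S2)).
      by rewrite -[LHS]mulr1 -c2; ring.
    by rewrite -ex -ey; ring.
  + transitivity (C2 * (B * S2 + d2 * C2) + S2 * (- B * C2 + d2 * S2)).
      by rewrite -[LHS]mulr1 -c2; ring.
    by rewrite -ex -ey; ring.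
- congr (_, _).
  + by rewrite -[LHS]mulr1 -c2; ring.
  + by rewrite -[LHS]mulr1 -c2; ring.
Qed.

(** The second equation of [same_projectionP] can be solved for [a], uniquely,
exactly when the sine is nonzero. When it vanishes, the lines are parallel and
cannot share one point only. *)
Lemma Gamma_meet_at_pointP (t1 t2 : R) :
  (exists q, Gamma t1 `&` Gamma t2 = [set q]) <->
  sin (theta t2 - theta t1) != 0.
Proof.
set D := theta t2 - theta t1.
split=> [[q Gq]|sD].
- apply/eqP => sD0.
  have [/Gamma_frame q1 /Gamma_frame q2] : (Gamma t1 `&` Gamma t2) q by rewrite Gq.
  (* translating q along the common direction stays on both lines *)
  pose q' := (q.1 + sin (theta t1), q.2 - cos (theta t1)).
  have : (Gamma t1 `&` Gamma t2) q'.
    split; apply/Gamma_frame => /=; first by rewrite -q1; ring.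
    rewrite -q2 -[RHS]subr0 -sD0 /D sinB; ring.
  rewrite Gq /= => /(congr1 (fun p => (p.1 - q.1, p.2 - q.2))).
  rewrite /= !subrr addrAC subrr add0r addrAC subrr add0r => -[s0 c0].
  have := cos2Dsin2 (theta t1); move/eqP: c0; rewrite oppr_eq0 => /eqP ->.
  by rewrite s0 expr0n /= addr0 => /eqP; rewrite eq_sym oner_eq0.
- pose a := (delta t1 * cos D - delta t2) / sin D.
  have aD : a * sin D = delta t1 * cos D - delta t2 by rewrite divfK.
  have G1 : Gamma t1 (X (a - xi t1, t1)).1 by apply/Gamma_pointP; exists (a - xi t1).
  exists (X (a - xi t1, t1)).1; apply/seteqP; split=> [q [] | q ->].
  + move=> /Gamma_pointP [s <-] /Gamma_pointP [s' /esym /same_projectionP[_]].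
    rewrite -/D => e; suff -> : s = a - xi t1 by [].
    have -> : a = s + xi t1 by apply: (mulIf sD); rewrite aD e; ring.
    by rewrite addrK.
  + split=> //; apply/Gamma_pointP.
    exists (a * cos D + delta t1 * sin D - xi t2).
    apply/esym/same_projectionP; rewrite -/D !subrK aD; split=> //; ring.
Qed.

(** Otherwise the line would meet itself in exactly one point, and
[Gamma_meet_at_pointP] for [t1] and [t1] would make [sin 0] nonzero. *)
Lemma eq_Gamma_parallel {t1 t2 : R} :
  Gamma t1 = Gamma t2 -> sin (theta t2 - theta t1) = 0.
Proof.
move=> e; apply/eqP/negPn/negP => /Gamma_meet_at_pointP[q].
rewrite -e setIid => Gq; have /Gamma_meet_at_pointP : exists q, Gamma t1 `&` Gamma t1 = [set q].
  by exists q; rewrite setIid.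
by rewrite subrr sin0 eqxx.
Qed.

Lemma parallel_eq_Gamma {t1 t2 : R} {q : R * R} :
  sin (theta t2 - theta t1) = 0 -> Gamma t1 q -> Gamma t2 q ->
  Gamma t1 = Gamma t2.
Proof.
move=> sD /Gamma_pointP[a <-] /Gamma_pointP[b /esym /same_projectionP[_ d2]].
have cc : cos (theta t2 - theta t1) ^+ 2 = 1.
  by rewrite -(cos2Dsin2 (theta t2 - theta t1)) sD expr0n addr0.
have d12 : delta t2 = delta t1 * cos (theta t2 - theta t1) by rewrite d2 sD; ring.
have d1 : delta t1 = delta t2 * cos (theta t2 - theta t1).
  by rewrite d12 -mulrA -expr2 cc mulr1.
set C := cos _ in cc d12 d1.
apply/seteqP; split=> p /Gamma_pointP [s <-]; apply/Gamma_pointP.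
- exists ((s + xi t1) * C - xi t2).
  apply/esym/same_projectionP; rewrite sD -/C subrK d12; split; ring.
- exists ((s + xi t2) * C - xi t1).
  apply/same_projectionP; rewrite sD -/C subrK -mulrA -expr2 cc d12; split; ring.
Qed.

(** The gap is [b * delta t2 - a * delta t1 + gamma t2 - gamma t1], in which [a]
and [b] are determined by [same_projectionP]. *)
Lemma height_gap {a b t1 t2 : R} : xi t1 = 0 -> xi t2 = 0 ->
  sin (theta t2 - theta t1) != 0 -> (X (a, t1)).1 = (X (b, t2)).1 ->
  (X (b, t2)).2 - (X (a, t1)).2 =
  (2 * delta t1 * delta t2
   - (delta t1 ^+ 2 + delta t2 ^+ 2) * cos (theta t2 - theta t1))
    / sin (theta t2 - theta t1) + gamma t2 - gamma t1.
Proof.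
move=> x1 x2 sD /same_projectionP; rewrite x1 x2 !addr0 !X_frame /=.
have := cos2Dsin2 (theta t2 - theta t1).
set C := cos _; set S := sin _ in sD *; move=> CS [-> d2].
suff -> : 2 * delta t1 * delta t2 - (delta t1 ^+ 2 + delta t2 ^+ 2) * C =
    ((a * C + delta t1 * S) * delta t2 - a * delta t1) * S.
  by rewrite mulfK //; ring.
rewrite d2.
apply/eqP; rewrite -subr_eq0.
have -> : 2 * delta t1 * (delta t1 * C - a * S)
    - (delta t1 ^+ 2 + (delta t1 * C - a * S) ^+ 2) * C
    - ((a * C + delta t1 * S) * (delta t1 * C - a * S) - a * delta t1) * S
  = (1 - (C ^+ 2 + S ^+ 2)) * (delta t1 ^+ 2 * C - a * delta t1 * S) by ring.
by rewrite CS subrr mul0r.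
Qed.

(** Here the rotation is plus or minus the identity, so that [b] and [delta t2]
are [a] and [delta t1] up to a common sign, and [b * delta t2 = a * delta t1]. *)
Lemma height_gap_parallel {a b t1 t2 : R} : xi t1 = 0 -> xi t2 = 0 ->
  sin (theta t2 - theta t1) = 0 -> (X (a, t1)).1 = (X (b, t2)).1 ->
  (X (b, t2)).2 - (X (a, t1)).2 = gamma t2 - gamma t1.
Proof.
move=> x1 x2 sD /same_projectionP; rewrite x1 x2 !addr0 !X_frame /=.
have := cos2Dsin2 (theta t2 - theta t1); rewrite sD expr0n /= !mulr0 subr0 !addr0.
move: (cos _) => C CC [-> ->].
rewrite mulrACA -expr2 CC; ring.
Qed.

Lemma X_injectiveP (I : set R) : (forall t, I t -> xi t = 0) ->
  (set_inj (setT `*` I) X <->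
   forall t1 t2, I t1 -> I t2 -> t1 <> t2 ->
     ((exists q, Gamma t1 `&` Gamma t2 = [set q]) ->
       (2 * delta t1 * delta t2
        - (delta t1 ^+ 2 + delta t2 ^+ 2) * cos (theta t2 - theta t1))
         / sin (theta t2 - theta t1)
       + gamma t2 - gamma t1 <> 0) /\
     (Gamma t1 = Gamma t2 -> gamma t1 <> gamma t2)).
Proof.
move=> xi0; split=> [injX t1 t2 I1 I2 t12|cond [a t1] [b t2]].
- have noX a b : (X (a, t1)).1 = (X (b, t2)).1 ->
      (X (b, t2)).2 - (X (a, t1)).2 <> 0.
    move=> e1 /eqP; rewrite subr_eq0 => /eqP e2; apply: t12.
    have [] // : (a, t1) = (b, t2).
    by apply: injX; rewrite ?inE //; apply/pair_equal_spec; split.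
  split=> [[q Gq]|eG].
  + have sD : sin (theta t2 - theta t1) != 0.
      by apply/Gamma_meet_at_pointP; exists q.
    have [/Gamma_pointP[a ea] /Gamma_pointP[b eb]] :
      (Gamma t1 `&` Gamma t2) q by rewrite Gq.
    have eab : (X (a, t1)).1 = (X (b, t2)).1 by rewrite ea eb.
    by rewrite -(height_gap (xi0 _ I1) (xi0 _ I2) sD eab); exact: noX.
  (* any point of the common line would do *)
  + have : Gamma t2 (X (0, t1)).1 by rewrite -eG; apply/Gamma_pointP; exists 0.
    move=> /Gamma_pointP[b /esym eb] eg; apply: (noX _ _ eb).
    rewrite (height_gap_parallel (xi0 _ I1) (xi0 _ I2)
      (eq_Gamma_parallel eG) eb).
    by rewrite eg subrr.
- rewrite !inE => -[_ I1] [_ I2] e; change (I t1) in I1; change (I t2) in I2.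
  have [t12|/eqP t12] := eqVneq t1 t2.
    move: e I1 I2; rewrite t12 => e _ _; congr (_, _).
    have /same_projectionP[] : (X (a, t2)).1 = (X (b, t2)).1 by rewrite e.
    by rewrite subrr cos0 sin0 mulr1 mulr0 addr0 => /addIr.
  have e1 := congr1 fst e.
  have e2 : (X (b, t2)).2 - (X (a, t1)).2 = 0 by rewrite e subrr.
  have [cpoint cline] := cond _ _ I1 I2 t12.
  have [sD|sD] := eqVneq (sin (theta t2 - theta t1)) 0.
  + exfalso; apply: cline.
      apply: (parallel_eq_Gamma (q := (X (a, t1)).1) sD); apply/Gamma_pointP.
        by exists a.
      by exists b.
    apply/esym/eqP; rewrite -subr_eq0.
    by rewrite -(height_gap_parallel (xi0 _ I1) (xi0 _ I2) sD e1) e2.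
  + exfalso; apply: cpoint; first exact/Gamma_meet_at_pointP.
    by rewrite -(height_gap (xi0 _ I1) (xi0 _ I2) sD e1) e2.
Qed.

(** * The first derivatives of the map *)

Section Derivatives.
Variables (t : R).
Hypotheses (dalpha : derivable alpha t 1) (dbeta : derivable beta t 1)
  (dgamma : derivable gamma t 1) (dtheta : derivable theta t 1).

Let is_derive1 {f : R -> R} : derivable f t 1 -> is_derive t 1 f (derive1 f t).
Proof. by move=> df; rewrite derive1E; exact: derivableP. Qed.

Let dsin : is_derive t 1 (sin \o theta) (cos (theta t) * derive1 theta t).
Proof. exact: is_derive1_comp _ (is_derive1 dtheta). Qed.

Let dcos : is_derive t 1 (cos \o theta) (- sin (theta t) * derive1 theta t).
Proof. exact: is_derive1_comp _ (is_derive1 dtheta). Qed.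

Lemma is_derive_delta :
  is_derive t 1 delta (derive1 alpha t * cos (theta t) + derive1 beta t * sin (theta t)
                       - xi t * derive1 theta t).
Proof.
have := is_deriveD (is_deriveM (is_derive1 dalpha) dcos)
                   (is_deriveM (is_derive1 dbeta) dsin).
move/is_derive_eq; apply; rewrite /xi /= /GRing.scale /=; ring.
Qed.

Lemma is_derive_xi :
  is_derive t 1 xi (derive1 alpha t * sin (theta t) - derive1 beta t * cos (theta t)
                    + delta t * derive1 theta t).
Proof.
have := is_deriveB (is_deriveM (is_derive1 dalpha) dsin)
                   (is_deriveM (is_derive1 dbeta) dcos).
move/is_derive_eq; apply; rewrite /delta /= /GRing.scale /=; ring.
Qed.

Lemma derive1_delta :
  derive1 delta t = derive1 alpha t * cos (theta t) + derive1 beta t * sin (theta t)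
                - xi t * derive1 theta t.
Proof. by have [_ e] := is_derive_delta; rewrite derive1E. Qed.

Lemma derive1_xi :
  derive1 xi t = derive1 alpha t * sin (theta t) - derive1 beta t * cos (theta t)
             + delta t * derive1 theta t.
Proof. by have [_ e] := is_derive_xi; rewrite derive1E. Qed.

Lemma is_diff_X (s : R) :
  is_diff (s, t) X (fun h =>
    (h.1 * sin (theta t)
       + h.2 * (s * (cos (theta t) * derive1 theta t) + derive1 alpha t),
     - h.1 * cos (theta t)
       + h.2 * (s * (sin (theta t) * derive1 theta t) + derive1 beta t),
     h.1 * delta t + h.2 * (s * derive1 delta t + derive1 gamma t))).
Proof.
have dx := is_diff_ruled s dsin (is_derive1 dalpha).
have dy := is_diff_ruled s (is_deriveN dcos) (is_derive1 dbeta).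
have dz := is_diff_ruled s is_derive_delta (is_derive1 dgamma).
have -> : X = (fun p : R * R =>
    (p.1 * (sin \o theta) p.2 + alpha p.2,
     p.1 * (- (cos \o theta)) p.2 + beta p.2,
     p.1 * delta p.2 + gamma p.2)).
  apply/funext => -[u v] /=; rewrite /delta !fctE /=; congr (_, _, _); ring.
apply: is_diff_eq; apply/funext => h /=.
rewrite -derive1_delta !fctE /=; congr (_, _, _); ring.
Qed.

(** The component along [(cos theta, sin theta)], normal to the line [Gamma t],
of the horizontal part of the derivative along [t]. *)
Lemma across_line (s : R) :
  (s * (cos (theta t) * derive1 theta t) + derive1 alpha t) * cos (theta t)
  + (s * (sin (theta t) * derive1 theta t) + derive1 beta t) * sin (theta t)
  = (s + xi t) * derive1 theta t + derive1 delta t.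
Proof.
rewrite derive1_delta -[s in RHS]mulr1 -(cos2Dsin2 (theta t)); ring.
Qed.

(** The component of the same vector along [(sin theta, - cos theta)], the
direction of the line. *)
Lemma along_line (s : R) :
  (s * (cos (theta t) * derive1 theta t) + derive1 alpha t) * sin (theta t)
  - (s * (sin (theta t) * derive1 theta t) + derive1 beta t) * cos (theta t)
  = derive1 xi t - delta t * derive1 theta t.
Proof. rewrite derive1_xi; ring. Qed.

Lemma injective_diff_XP (s : R) :
  injective ('d X (s, t)) <->
  ~ ((s + xi t) * derive1 theta t + derive1 delta t = 0) \/
  ~ (s * derive1 delta t + derive1 gamma t
     - delta t * (derive1 xi t - delta t * derive1 theta t) = 0).
Proof.
rewrite (@diff_val _ _ _ _ _ _ _ (is_diff_X s)) -not_andE.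
have c2s2 := cos2Dsin2 (theta t).
by rewrite (frame_injectiveP c2s2) across_line along_line.
Qed.

Lemma singular_at_XP (s : R) :
  singular_at X (s, t) <->
  ((s + xi t) ^+ 2 + delta t ^+ 2) * derive1 theta t
  + (2 * s + xi t) * derive1 delta t
  + derive1 gamma t - delta t * derive1 xi t = 0.
Proof.
have dfX : differentiable X (s, t) by have [] := is_diff_X s.
rewrite /singular_at !deriveE // (@diff_val _ _ _ _ _ _ _ (is_diff_X s)).
rewrite X_frame /= !mul1r !mul0r !addr0 !add0r mulN1r oppr0 !mul0r !add0r.
rewrite (frame_cross_parallelP (cos2Dsin2 (theta t))) across_line along_line.
rewrite [X in X = 0 <-> _](_ : _ =
  ((s + xi t) ^+ 2 + delta t ^+ 2) * derive1 theta t
  + (2 * s + xi t) * derive1 delta t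
  + derive1 gamma t - delta t * derive1 xi t) //; ring.
Qed.

End Derivatives.
End MovingFrame.

Theorem theoremA (R : realType) (I : set R) (alpha beta gamma theta : R -> R)
  (openI : open I) (intervalI : is_interval I)
  (C2alpha : C2 I alpha) (C2beta : C2 I beta)
  (C2gamma : C2 I gamma) (C2theta : C2 I theta) :
  let X := X alpha beta gamma theta in
  let delta := delta alpha beta theta in
  let xi := xi alpha beta theta in
  let Gamma := Gamma alpha beta theta in
  [/\ (immersion_on (setT `*` I) X <->
        forall s t : R, I t ->
          ~ ((s + xi t) * derive1 theta t + derive1 delta t = 0) \/
          ~ (s * derive1 delta t + derive1 gamma t
             - delta t * (derive1 xi t - delta t * derive1 theta t) = 0)),
      (forall s t : R, I t ->
        (singular_at X (s, t) <->
          ((s + xi t) ^+ 2 + delta t ^+ 2) * derive1 theta t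
          + (2 * s + xi t) * derive1 delta t
          + derive1 gamma t - delta t * derive1 xi t = 0))
    & ((forall t, I t -> xi t = 0) ->
        (set_inj (setT `*` I) X <->
          forall t1 t2, I t1 -> I t2 -> t1 <> t2 ->
            ((exists q, Gamma t1 `&` Gamma t2 = [set q]) ->
              (2 * delta t1 * delta t2
               - (delta t1 ^+ 2 + delta t2 ^+ 2) * cos (theta t2 - theta t1))
                / sin (theta t2 - theta t1)
              + gamma t2 - gamma t1 <> 0) /\
            (Gamma t1 = Gamma t2 -> gamma t1 <> gamma t2)))].
Proof.
have d1 f : C2 I f -> forall t, I t -> derivable f t 1.
  by move=> C2f t It; have [] := C2f t It.
have [da db] := (d1 _ C2alpha, d1 _ C2beta).
have [dg dth] := (d1 _ C2gamma, d1 _ C2theta).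
move=> X' delta' xi' Gamma'; split.
- split=> [immX s t It|indep [s t] [_ It]].
  + apply/injective_diff_XP; [exact: da|exact: db|exact: dg|exact: dth|].
    by have [] := immX (s, t) (conj Logic.I It).
  + have {}It : I t by [].
    split.
      by case: (is_diff_X _ _ _ _ _ (da t It) (db t It) (dg t It) (dth t It) s).
    apply/injective_diff_XP; [exact: da|exact: db|exact: dg|exact: dth|].
    exact: indep.
- move=> s t It.
  by apply: singular_at_XP; [exact: da|exact: db|exact: dg|exact: dth].
- exact: X_injectiveP.
Qed.
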